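(* Let $M$ be an oriented hypersurface in the Euclidean space $\mathbb{E}^{n+1}$ and let $x:M\rightarrow\mathbb{E}^{n+1}$ be its position vector, with tangential component $x^T$. Let $\theta$ be the angle function defined by $\mu\cos\theta=\langle x,N\rangle$, where $\mu=\langle x,x\rangle^{1/2}$ and $N$ is the unit normal vector field of $M$. Then $x^T$ is a principal direction of $M$ if and only if $Y(\theta)=0$ whenever $Y$ is a vector field tangent to $M$ and orthogonal to $x^T$.
   Context: $\mathbb{E}^{n+1}$ is Euclidean space with its canonical metric $\langle\cdot,\cdot\rangle$. Hypersurfaces are smooth, connected and immersed. The position vector $x$ is taken with respect to the origin, and $x=x^T+x^\perp$ is its decomposition into tangential and normal components along $M$. One writes $x=\mu\sin\theta\, e_1+\mu\cos\theta\, N$, where $e_1$ is a unit tangent vector field along $x^T$ (so one works where $x\neq 0$ and $x^T\neq 0$). The shape operator $S$ of $M$ along $N$ is given by $S(X)=-\widetilde\nabla_X N$, with $\widetilde\nabla$ the Levi-Civita connection of $\mathbb{E}^{n+1}$; ''$x^T$ is a principal direction'' means that $x^T$ is an eigenvector of $S$ at each point. *)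

(* Defs.v *)
From HB Require Import structures.
From mathcomp Require Import all_boot all_order all_algebra.
From mathcomp Require Import all_classical all_reals all_analysis.

Set Implicit Arguments.
Unset Strict Implicit.
Unset Printing Implicit Defensive.

Import Order.TTheory GRing.Theory Num.Theory.
Import numFieldNormedType.Exports.

Local Open Scope classical_set_scope.
Local Open Scope ring_scope.

(* The topology of ['rV[R]_m] is induced by the sup norm, which is equivalent
   to the Euclidean one; lengths and angles are always taken from [dot]. *)
Definition dot (R : realType) (m : nat) (u v : 'rV[R]_m) : R :=
  \sum_(k < m) u 0 k * v 0 k.

(* [Ck k U f] is meaningful for [U] open: then [f] is of class C^k on [U]. *)
Fixpoint Ck (R : realType) (V W : normedModType R) (k : nat) (U : set V)
    (f : V -> W) : Prop :=
  if k is k'.+1 then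
    (forall u, U u -> differentiable f u) /\
    (forall v, Ck k' U (fun u => 'D_v f u))
  else forall u, U u -> {for u, continuous f}.

Definition smooth_on (R : realType) (V W : normedModType R) (U : set V)
    (f : V -> W) : Prop :=
  forall k, Ck k U f.

(* [param i] is only relevant on [chart i @` dom i], where it is the inverse
   of the coordinate map [chart i]. *)
Record smooth_atlas (R : realType) (n : nat) (M : topologicalType) :=
  SmoothAtlas {
    chart_index : Type;
    dom : chart_index -> set M;
    chart : chart_index -> M -> 'rV[R]_n;
    param : chart_index -> 'rV[R]_n -> M;
    chart_at : M -> chart_index;
    dom_chart_at : forall p, dom (chart_at p) p;
    dom_open : forall i, open (dom i);
    img_open : forall i, open (chart i @` dom i);
    chartK : forall i p, dom i p -> param i (chart i p) = p;
    chart_cont : forall i p, dom i p -> {for p, continuous (chart i)};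
    param_cont : forall i p, dom i p ->
      {for chart i p, continuous (param i)};
    transition_smooth : forall i j,
      smooth_on (chart i @` (dom i `&` dom j)) (chart j \o param i)
  }.

Section Hypersurface.
Variables (R : realType) (n : nat) (M : topologicalType).
Variable A : smooth_atlas R n M.

Definition smooth_map_on (V : normedModType R) (W : set M) (F : M -> V) :
    Prop :=
  forall i : chart_index A,
    smooth_on (chart i @` (dom i `&` W)) (F \o param i).

(* Differential at [p] of a map on [M], read in the chart around [p]. *)
Definition mdiff (V : normedModType R) (F : M -> V) (p : M) : 'rV[R]_n -> V :=
  'd (F \o param (chart_at A p)) (chart (chart_at A p) p).

Definition immersion (x : M -> 'rV[R]_n.+1) : Prop :=
  smooth_map_on [set: M] x /\ forall p, injective (mdiff x p).

Variable x : M -> 'rV[R]_n.+1.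

(* Tangent vectors of the immersed hypersurface at [p] are identified with
   their images in the ambient space under the differential of [x]. *)
Definition tangent (p : M) (v : 'rV[R]_n.+1) : Prop :=
  exists w : 'rV[R]_n, mdiff x p w = v.

(* Derivative at [p] of a map on [M] along the tangent vector [v]: the
   coordinates of [v] are recovered by inverting the differential of [x].
   By the chain rule the result does not depend on the chart. *)
Definition deriv_along (V : normedModType R) (F : M -> V) (p : M)
    (v : 'rV[R]_n.+1) : V :=
  mdiff F p (xget 0 [set w | mdiff x p w = v]).

Variable N : M -> 'rV[R]_n.+1.

Definition unit_normal : Prop :=
  [/\ smooth_map_on [set: M] N,
      (forall p, dot (N p) (N p) = 1)
    & (forall p v, tangent p v -> dot v (N p) = 0)].

Definition normal_part (p : M) : 'rV[R]_n.+1 := dot (x p) (N p) *: N p.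

Definition tangential_part (p : M) : 'rV[R]_n.+1 := x p - normal_part p.

(* The Levi-Civita connection of the Euclidean space is the directional
   derivative. *)
Definition shape_operator (p : M) (v : 'rV[R]_n.+1) : 'rV[R]_n.+1 :=
  - deriv_along N p v.

Definition principal_direction (p : M) (v : 'rV[R]_n.+1) : Prop :=
  [/\ tangent p v, v != 0 & exists k : R, shape_operator p v = k *: v].

Definition position_length (p : M) : R := Num.sqrt (dot (x p) (x p)).

(* The bounds make [theta p] the angle between [x p] and [N p]; the defining
   equation alone would only determine it up to sign and multiples of 2 pi. *)
Definition angle_function (theta : M -> R) : Prop :=
  forall p, 0 <= theta p <= pi /\
    position_length p * cos (theta p) = dot (x p) (N p).

(* The points at which the decomposition of [x] along a unit tangent vector
   in the direction of its tangential part and [N] makes sense. *)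
Definition regular_set : set M := [set p | tangential_part p != 0].

Definition tangent_field_on (W : set M) (Y : M -> 'rV[R]_n.+1) : Prop :=
  smooth_map_on W Y /\ forall p, W p -> tangent p (Y p).

End Hypersurface.

(* Main.v *)
(** Differentiating [mu cos theta = <x, N>] along a tangent vector [Y]
    orthogonal to [x^T], the length [mu] is stationary and
    [<Y, N> = 0], so [Y(theta)] is a nonzero multiple of
    [<x^T, dN(Y)> = - <x^T, S Y> = - <S x^T, Y>], the last step being the
    symmetry of the shape operator, that is, of the second derivatives of
    the immersion.  Hence [theta] is stationary in all such directions iff
    [S x^T] has no tangential component orthogonal to [x^T].  For the converse
    one vector field per point suffices: [S x^T] at [p], seen as a constant
    vector of the ambient space, made tangent and orthogonal to [x^T] at every
    point by projection; no bump function is needed. *)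

Require Import Defs.
From HB Require Import structures.
From mathcomp Require Import all_boot all_order all_algebra.
From mathcomp Require Import all_classical all_reals all_analysis.

Import Order.TTheory GRing.Theory Num.Theory.
Import numFieldNormedType.Exports.

Local Open Scope classical_set_scope.
Local Open Scope ring_scope.

Set Implicit Arguments.
Unset Strict Implicit.
Unset Printing Implicit Defensive.

(** * Germs of differentiable maps and symmetry of mixed second derivatives *)

(** The first-order expansion of [f] at [a] is also one of [g], and a continuous linear map with
    this expansion can only be the differential. *)
Lemma near_eq_diff (R : realType) (V W : normedModType R) (f g : V -> W) a :
  (\near a, f a = g a) -> differentiable f a ->
  differentiable g a /\ 'd g a = 'd f a :> (V -> W).
Proof.
move=> fg df.
have key : g \o shift a = cst (g a) + 'd f a +o_ 0 id.
  apply/eqaddoP => e e0.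
  have /eqaddoP/(_ e e0) := diff_locally df.
  have fg0 : \forall h \near (0 : V), f (h + a) = g (h + a).
    have ca : (fun h : V => h + a) @ 0 --> a.
      rewrite -[X in _ --> X]add0r.
      by apply: cvgD; [exact: cvg_id|exact: cvg_cst].
    exact: ca fg.
  apply: filterS2 fg0 => h /= fgh.
  by rewrite !fctE /= fgh (nbhs_singleton fg).
have dc := diff_continuous df.
have dgE := diff_unique dc key.
by split=> //; apply/diff_locallyP; rewrite dgE.
Qed.

Lemma is_derive_line (R : realType) (V W : normedModType R) (f : V -> W)
    (c v : V) (s : R) :
  differentiable f (c + s *: v) ->
  is_derive s 1 (fun t => f (c + t *: v)) ('D_v f (c + s *: v)).
Proof.
move=> df; rewrite deriveE//.
have dl : is_diff s (fun t => c + t *: v) (fun t => t *: v).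
  apply: is_diff_eq; by rewrite add0r.
have dc : is_diff s (f \o (fun t => c + t *: v))
    ('d f (c + s *: v) \o (fun t => t *: v)).
  by apply: is_diff_comp; apply: differentiableP.
have dd : differentiable (f \o (fun t => c + t *: v)) s by apply: ex_diff.
apply: DeriveDef; first exact: diff_derivable.
by rewrite deriveE// diff_val /= scale1r.
Qed.

Lemma mean_value0 (R : realType) (f df : R -> R) (t : R) :
  0 < t -> (forall s, 0 <= s <= t -> is_derive s 1 f (df s)) ->
  exists2 a, 0 <= a <= t & f t - f 0 = df a * t.
Proof.
move=> t0 dF; have [|||a aI E] := @MVT_segment R f df 0 t.
- exact: ltW.
- move=> s; rewrite in_itv/= => /andP[/ltW s0 /ltW st].
  by apply: dF; rewrite s0.
- apply: derivable_within_continuous => s; rewrite in_itv/= => sI.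
  by have [] := dF s sI.
by exists a; [rewrite in_itv/= in aI|rewrite E subr0].
Qed.

(* Up to [addrC], the left-hand side of the equation is symmetric in [v] and
   [w] whereas the right-hand side is not: this yields [derive_comm]. *)
Lemma second_difference (R : realType) (V : normedModType R) (U : set V)
    (f : V -> R) (u v w : V) (t : R) :
  0 < t -> Ck 2 U f ->
  (forall a b, 0 <= a <= t -> 0 <= b <= t -> U (u + a *: v + b *: w)) ->
  exists a b, [/\ 0 <= a <= t, 0 <= b <= t &
    f (u + t *: v + t *: w) - f (u + t *: v) - (f (u + t *: w) - f u) =
    'D_w ('D_v f) (u + a *: v + b *: w) * t * t].
Proof.
move=> t0 [df /(_ v) [dDf _]] box.
have tI : 0 <= t <= t by rewrite lexx ltW.
have zI : (0 : R) <= 0 <= t by rewrite lexx ltW.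
have dF1 s : 0 <= s <= t ->
    is_derive s 1 (fun s => f (u + t *: w + s *: v))
      ('D_v f (u + s *: v + t *: w)).
  move=> sI; rewrite addrAC; apply: is_derive_line; apply: df.
  by rewrite addrAC; apply: box.
have dF2 s : 0 <= s <= t ->
    is_derive s 1 (fun s => f (u + s *: v)) ('D_v f (u + s *: v)).
  move=> sI; apply: is_derive_line; apply: df.
  by have := box s 0 sI zI; rewrite scale0r addr0.
have dF s : 0 <= s <= t ->
    is_derive s 1
      ((fun s => f (u + t *: w + s *: v)) - (fun s => f (u + s *: v)))
      ('D_v f (u + s *: v + t *: w) - 'D_v f (u + s *: v)).
  by move=> sI; apply: is_deriveB; [exact: dF1|exact: dF2].
(* The mean value theorem is used twice: along [v] for the increment of [f] over [t *: w], then
   along [w] for ['D_v f]. *)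
have [a aI Ea] := mean_value0 t0 dF.
have dG b : 0 <= b <= t ->
    is_derive b 1 (fun b => 'D_v f (u + a *: v + b *: w))
      ('D_w ('D_v f) (u + a *: v + b *: w)).
  by move=> bI; apply: is_derive_line; apply: dDf; apply: box.
have [b bI Eb] := mean_value0 t0 dG.
exists a, b; split=> //.
move: Ea Eb; rewrite !fctE !scale0r !addr0 => Ea Eb.
rewrite Eb in Ea.
by rewrite -Ea; congr (_ - _ - _); rewrite addrAC.
Qed.

Lemma near_box (R : realType) (V : normedModType R) (u v w : V) (B : set V) :
  nbhs u B -> exists2 t : R, 0 < t &
  forall a b, 0 <= a <= t -> 0 <= b <= t -> B (u + a *: v + b *: w).
Proof.
move=> /nbhs_normP[e /= e0 eB].
have n0 : 0 < `|v| + `|w| + 1 by rewrite ltr_wpDl// addr_ge0.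
(* The summand 1 keeps the denominator positive when [v] and [w] both vanish, and makes the final
   bound strict. *)
exists (e / (`|v| + `|w| + 1)); first exact: divr_gt0.
move=> a b /andP[a0 ae] /andP[b0 be]; apply: eB => /=.
rewrite -addrA opprD addNKr normrN (le_lt_trans (ler_normD _ _))//.
rewrite !normrZ (ger0_norm a0) (ger0_norm b0).
apply: (@le_lt_trans _ _ (e / (`|v| + `|w| + 1) * (`|v| + `|w|))).
  by rewrite mulrDr lerD// ler_wpM2r.
by rewrite mulrAC -mulrA gtr_pMr// ltr_pdivrMr// mul1r ltrDl.
Qed.

(** Each mixed derivative, taken at some point of a small box at [u], equals the same second
    difference divided by [t * t]. By continuity both values are within [e / 2] of those at [u]. *)
Lemma derive_comm (R : realType) (V : normedModType R) (U : set V)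
    (f : V -> R) (u v w : V) :
  open U -> U u -> Ck 2 U f -> 'D_w ('D_v f) u = 'D_v ('D_w f) u.
Proof.
move=> oU Uu f2; apply/eqP; rewrite -subr_eq0 -normr_le0.
apply/ler_addgt0Pr => e e0; rewrite add0r.
have [_ fD] := f2.
have [_ /(_ w) cwv] := fD v; have [_ /(_ v) cvw] := fD w.
have e20 : 0 < e / 2 by rewrite divr_gt0.
have UB : nbhs u U by apply: open_nbhs_nbhs.
have /cvgrPdist_le/(_ _ e20) B1 := cwv u Uu.
have /cvgrPdist_le/(_ _ e20) B2 := cvw u Uu.
have [t t0 box] := near_box v w (filterI UB (filterI B1 B2)).
have [|a [b [aI bI E1]]] := @second_difference R V U f u v w t t0 f2.
  by move=> a b aI bI; have [] := box a b aI bI.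
have [|b' [a' [bI' aI' E2]]] := @second_difference R V U f u w v t t0 f2.
  by move=> b' a' bI' aI'; rewrite addrAC; have [] := box a' b' aI' bI'.
have [_ [/= P1 _]] := box a b aI bI.
have [_ [_ /=]] := box a' b' aI' bI'.
have E3 : f (u + t *: w + t *: v) = f (u + t *: v + t *: w).
  by congr f; exact: addrAC.
rewrite {}E3 in E2.
have -> : u + a' *: v + b' *: w = u + b' *: w + a' *: v by exact: addrAC.
move: E1 E2 P1.
set p := 'D_w ('D_v f) _; set q := 'D_v ('D_w f) _.
set p' := 'D_w ('D_v f) u; set q' := 'D_v ('D_w f) u.
move: p q p' q' (f _) (f _) (f _) (f _) => p q p' q' f1 f2' f3 f4 E1 E2 P1 P2.
have E : p = q.
  have tt : t * t != 0 by rewrite mulf_neq0// gt_eqF.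
  apply: (mulIf tt); rewrite !mulrA -E1 -E2 !opprB addrACA [RHS]addrACA.
  by congr (_ + _); rewrite addrC.
rewrite -(subrKA p) (splitr e) (le_trans (ler_normD _ _))// lerD//.
by rewrite E distrC.
Qed.

(** * Stability rules for maps of class C^k *)

Lemma Ck_sub (R : realType) (V W : normedModType R) k (U U' : set V)
    (f : V -> W) : U' `<=` U -> Ck k U f -> Ck k U' f.
Proof.
move=> sU; elim: k f => [|k IH] f /=; first by move=> cf u /sU; exact: cf.
by move=> [df Df]; split=> [u /sU /df//|v]; exact: IH.
Qed.

(** The differentiation rules hold only at points of [U], so in the inductions below ['D_v] of a sum
    or product is known only there. Since [U] is open, agreement on [U] is agreement near each of
    its points and passes to derivatives. *)
Lemma Ck_eq (R : realType) (V W : normedModType R) k (U : set V)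
    (f g : V -> W) :
  open U -> (forall u, U u -> f u = g u) -> Ck k U f -> Ck k U g.
Proof.
move=> oU; have near_eq (f' g' : V -> W) u : (forall u, U u -> f' u = g' u) ->
    U u -> \near u, f' u = g' u.
  by move=> fg Uu; apply: filterS (open_nbhs_nbhs (conj oU Uu)) => z /fg.
elim: k f g => [|k IH] f g fg /=.
  move=> cf u Uu; change (g x @[x --> u] --> g u); rewrite -(fg _ Uu).
  by apply: cvg_trans (cf u Uu); apply: near_eq_cvg; exact: near_eq.
move=> [df Df]; split=> [u Uu|v].
  by have [] := near_eq_diff (near_eq _ _ _ fg Uu) (df u Uu).
by apply: IH (Df v) => u Uu; apply: near_eq_derive; exact: near_eq.
Qed.

Lemma Ck_pred (R : realType) (V W : normedModType R) k (U : set V)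
    (f : V -> W) : Ck k.+1 U f -> Ck k U f.
Proof.
elim: k f => [|k IH] f [df Df].
  by move=> u /df; exact: differentiable_continuous.
by split=> // v; exact: IH (Df v).
Qed.

Lemma Ck_cst (R : realType) (V W : normedModType R) k (U : set V) (c : W) :
  Ck k U (fun _ : V => c).
Proof.
elim: k c => [|k IH] c /=; first by move=> u _; exact: cst_continuous.
split=> [u _|v]; first exact: differentiable_cst.
have -> : (fun u => 'D_v (fun _ : V => c) u) = (fun=> 0).
  by apply/funext => u; exact: derive_cst.
exact: IH.
Qed.

Lemma CkD (R : realType) (V W : normedModType R) k (U : set V)
    (f g : V -> W) :
  open U -> Ck k U f -> Ck k U g -> Ck k U (fun u => f u + g u).
Proof.
move=> oU; elim: k f g => [|k IH] f g /=.
  by move=> cf cg u Uu; apply: continuousD; [exact: cf|exact: cg].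
move=> [df Df] [dg Dg]; split=> [u Uu|v].
  exact: differentiableD (df u Uu) (dg u Uu).
apply: Ck_eq (IH _ _ (Df v) (Dg v)) => // u Uu.
by rewrite deriveD//; apply: diff_derivable; [exact: df|exact: dg].
Qed.

Lemma CkN (R : realType) (V W : normedModType R) k (U : set V) (f : V -> W) :
  open U -> Ck k U f -> Ck k U (fun u => - f u).
Proof.
move=> oU; elim: k f => [|k IH] f /=.
  by move=> cf u Uu; apply: continuousN; exact: cf.
move=> [df Df]; split=> [u Uu|v].
  exact: differentiableN (df u Uu).
apply: Ck_eq (IH _ (Df v)) => // u Uu.
by rewrite deriveN//; apply: diff_derivable; exact: df.
Qed.

Lemma CkB (R : realType) (V W : normedModType R) k (U : set V)
    (f g : V -> W) :
  open U -> Ck k U f -> Ck k U g -> Ck k U (fun u => f u - g u).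
Proof. by move=> oU cf cg; apply: (CkD oU cf (CkN oU cg)). Qed.

Lemma is_diff_bilinear (R : realType) (V W1 W2 W3 : normedModType R)
    (op : {bilinear W1 -> W2 -> W3}) (f : V -> W1) (g : V -> W2) u :
  continuous (fun p => op p.1 p.2) -> differentiable f u ->
  differentiable g u ->
  is_diff u (fun z => op (f z) (g z))
    (fun v => op (f u) ('d g u v) + op ('d f u v) (g u)).
Proof.
move=> cop df dg.
have dop : is_diff (f u, g u) (fun p => op p.1 p.2)
    (fun q => op (f u) q.2 + op q.1 (g u)).
  by apply: DiffDef; [exact: differentiable_bilin|exact: diff_bilin].
have dfg : is_diff u (fun z => (f z, g z)) (fun v => ('d f u v, 'd g u v)).
  by apply: is_diff_pair; exact: differentiableP.
exact: (is_diff_comp dfg dop).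
Qed.

(** One induction that serves both the inner product and the scaling of vectors by functions. *)
Lemma Ck_bilinear (R : realType) (V W1 W2 W3 : normedModType R)
    (op : {bilinear W1 -> W2 -> W3}) k (U : set V) (f : V -> W1)
    (g : V -> W2) :
  continuous (fun p => op p.1 p.2) -> open U ->
  Ck k U f -> Ck k U g -> Ck k U (fun u => op (f u) (g u)).
Proof.
move=> cop oU; elim: k f g => [|k IH] f g.
  move=> cf cg u Uu.
  apply: (@continuous_comp _ _ _ (fun u => (f u, g u)) (fun p => op p.1 p.2)).
    by apply: cvg_pair; [exact: cf|exact: cg].
  exact: cop.
(* Each term of the product rule keeps one factor undifferentiated, which must be lowered to class
   C^k for the induction hypothesis. *)
move=> f1 g1; have f0 := Ck_pred f1; have g0 := Ck_pred g1.
case: f1 g1 => [df Df] [dg Dg].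
split=> [u Uu|v].
  exact: (ex_diff (is_diff_def := is_diff_bilinear cop (df u Uu) (dg u Uu))).
apply: Ck_eq (CkD oU (IH _ _ f0 (Dg v)) (IH _ _ (Df v) g0)) => // u Uu.
have dop := is_diff_bilinear cop (df u Uu) (dg u Uu).
rewrite (deriveE v (ex_diff (is_diff_def := dop))) diff_val !deriveE//.
  exact: df.
exact: dg.
Qed.

(** * The Euclidean inner product and hyperplanes *)

Section Dot.
Variables (R : realType) (m : nat).
Implicit Types u v w : 'rV[R]_m.

Lemma dotC u v : dot u v = dot v u.
Proof. by apply: eq_bigr => k _; rewrite mulrC. Qed.

Lemma dot_is_bilinear :
  bilinear_for (GRing.Scale.Law.clone _ _ *:%R _)
    (GRing.Scale.Law.clone _ _ *:%R _)
    (@dot R m : 'rV[R]_m -> 'rV[R]_m -> R).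
Proof.
split=> [v|u] a x y /=.
  rewrite [RHS](_ : _ = a * dot x v + dot y v)// /dot mulr_sumr -big_split.
  by apply: eq_bigr => k _; rewrite !mxE mulrDl mulrA.
rewrite [RHS](_ : _ = a * dot u x + dot u y)// /dot mulr_sumr -big_split.
by apply: eq_bigr => k _; rewrite !mxE mulrDr mulrCA.
Qed.

HB.instance Definition _ := bilinear_isBilinear.Build R 'rV[R]_m 'rV[R]_m R
  _ _ (@dot R m) dot_is_bilinear.

Lemma dotBl u v w : dot (u - v) w = dot u w - dot v w.
Proof. exact: (linearBl (@dot R m) w). Qed.

Lemma dotZl a u v : dot (a *: u) v = a * dot u v.
Proof. exact: (linearZl_LR (@dot R m) v). Qed.

Lemma dotBr u v w : dot w (u - v) = dot w u - dot w v.
Proof. exact: (linearBr (@dot R m) w). Qed.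

Lemma dotNr u v : dot u (- v) = - dot u v.
Proof. exact: (linearNr (@dot R m) u). Qed.

Lemma dotZr a u v : dot v (a *: u) = a * dot v u.
Proof. exact: (linearZr_LR (@dot R m) v). Qed.

Lemma dot0r u : dot u 0 = 0.
Proof. exact: (linear0r (@dot R m) u). Qed.

Lemma dot_ge0 u : 0 <= dot u u.
Proof. by apply: sumr_ge0 => k _; rewrite -expr2 sqr_ge0. Qed.

Lemma dot_eq0 u : (dot u u == 0) = (u == 0).
Proof.
apply/eqP/eqP => [/eqP|->]; last by apply: big1 => k _; rewrite mxE mul0r.
rewrite psumr_eq0 => [/allP u0|k _]; last by rewrite -expr2 sqr_ge0.
apply/rowP => k; rewrite mxE; have := u0 k (mem_index_enum k).
by rewrite mulf_eq0 orbb => /eqP.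
Qed.

Lemma dot_mulmx u v : u *m v^T = (dot u v)%:M.
Proof.
apply/rowP => i; rewrite !mxE ord1 eqxx mulr1n.
by apply: eq_bigr => k _; rewrite mxE.
Qed.

Lemma dot_continuous :
  continuous (fun p : 'rV[R]_m * 'rV[R]_m => dot p.1 p.2 : R).
Proof.
apply: continuous_big => [|k _ p]; first exact: (@add_continuous R).
apply: (@cvgM R).
  apply: (@continuous_comp _ _ _ fst (fun u : 'rV[R]_m => u 0 k)).
    exact: cvg_fst.
  exact: coord_continuous.
apply: (@continuous_comp _ _ _ snd (fun u : 'rV[R]_m => u 0 k)).
  exact: cvg_snd.
exact: coord_continuous.
Qed.

End Dot.

Lemma scale_is_bilinear (R : realType) (W : normedModType R) :
  bilinear_for (GRing.Scale.Law.clone _ _ *:%R _)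
    (GRing.Scale.Law.clone _ _ *:%R _) ( *:%R : R -> W -> W).
Proof.
split=> [v|u] a x y; first by rewrite scalerDl -scalerA.
by rewrite /= scalerDr !scalerA mulrC.
Qed.

HB.instance Definition _ (R : realType) (W : normedModType R) :=
  bilinear_isBilinear.Build R R W W _ _ *:%R (@scale_is_bilinear R W).

(** A dimension count: the image of [J] has rank [n] and lies in the orthogonal of [nu], which also
    has dimension [n], so the two coincide. *)
Lemma tangent_hyperplane (R : realType) n (J : {linear 'rV[R]_n -> 'rV[R]_n.+1})
    (nu y : 'rV[R]_n.+1) :
  injective J -> nu != 0 -> (forall w, dot (J w) nu = 0) -> dot y nu = 0 ->
  exists w, J w = y.
Proof.
move=> injJ nu0 Jnu ynu; pose A := lin1_mx J.
have freeA : row_free A.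
  rewrite -kermx_eq0; apply/rowV0P => w /sub_kermxP.
  by rewrite mul_rV_lin1 -[RHS](linear0 J) => /injJ.
have AK : (A <= kermx nu^T)%MS.
  apply/sub_kermxP/row_matrixP => i; rewrite row_mul row0 rowE mul_rV_lin1.
  by rewrite dot_mulmx Jnu raddf0.
have [_] := mxrank_leqif_sup AK.
rewrite mxrank_ker mxrank_tr rank_rV nu0 subSS subn0 (eqP freeA) eqxx.
move=> /esym KA.
have : (y <= A)%MS.
  by apply: submx_trans KA; apply/sub_kermxP; rewrite dot_mulmx ynu raddf0.
by move=> /submxP[w ->]; exists w; rewrite mul_rV_lin1.
Qed.

(** * Differentiation of inner products *)

Section DotCalculus.
Variables (R : realType) (V : normedModType R) (m : nat).
Implicit Types f g : V -> 'rV[R]_m.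

Lemma differentiable_dot f g u : differentiable f u -> differentiable g u ->
  differentiable (fun z => dot (f z) (g z)) u.
Proof.
move=> df dg.
by have [] := is_diff_bilinear (op := @dot R m) (@dot_continuous R m) df dg.
Qed.

Lemma diff_dot f g u v : differentiable f u -> differentiable g u ->
  'd (fun z => dot (f z) (g z)) u v =
  dot (f u) ('d g u v) + dot ('d f u v) (g u).
Proof.
move=> df dg.
by have [_ ->] := is_diff_bilinear (op := @dot R m) (@dot_continuous R m) df dg.
Qed.

Lemma derive_dot f g u v : differentiable f u -> differentiable g u ->
  'D_v (fun z => dot (f z) (g z)) u =
  dot (f u) ('D_v g u) + dot ('D_v f u) (g u).
Proof.
move=> df dg; rewrite (deriveE v df) (deriveE v dg) -diff_dot//.
by apply: deriveE; exact: differentiable_dot.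
Qed.

Lemma Ck_dot k (U : set V) f g : open U -> Ck k U f -> Ck k U g ->
  Ck k U (fun z => dot (f z) (g z)).
Proof. exact: (Ck_bilinear (op := @dot R m) (@dot_continuous R m)). Qed.

End DotCalculus.

Lemma CkZ (R : realType) (V W : normedModType R) k (U : set V)
    (c : V -> R) (g : V -> W) :
  open U -> Ck k U c -> Ck k U g -> Ck k U (fun u => c u *: g u).
Proof.
exact: (Ck_bilinear (op := *:%R : R -> W -> W) (@scale_continuous R W)).
Qed.

(** Pairing with a constant vector [c] reduces to the scalar case; the difference of the two
    derivatives is then orthogonal to every [c], itself included. *)
Lemma derive_comm_rV (R : realType) (V : normedModType R) m (U : set V)
    (f : V -> 'rV[R]_m) (u v w : V) :
  open U -> U u -> Ck 2 U f -> 'D_w ('D_v f) u = 'D_v ('D_w f) u.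
Proof.
move=> oU Uu f2.
have dotD (a b : V) (c : 'rV[R]_m) :
    'D_b ('D_a (fun z => dot (f z) c : R)) u = dot ('D_b ('D_a f) u) c.
  have dc (g : V -> 'rV[R]_m) z e : differentiable g z ->
      'D_e (fun z => dot (g z) c) z = dot ('D_e g z) c.
    by move=> dg; rewrite derive_dot// derive_cst dot0r add0r.
  have [df /(_ a) [dDf _]] := f2.
  rewrite -(dc _ _ _ (dDf u Uu)).
  apply: near_eq_derive.
  by apply: filterS (open_nbhs_nbhs (conj oU Uu)) => z Uz; apply: dc; exact: df.
have Edot c : dot ('D_w ('D_v f) u) c = dot ('D_v ('D_w f) u) c.
  refine (etrans (esym (dotD v w c)) (etrans _ (dotD w v c))).
  refine (derive_comm v w oU Uu _).
  exact (@Ck_dot _ _ _ 2 U f (fun=> c) oU f2 (@Ck_cst _ _ _ 2 U c)).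
apply: subr0_eq; apply/eqP; move: Edot.
move: ('D_w _ u) ('D_v _ u) => P Q PQ.
by rewrite -dot_eq0 dotBl PQ subrr.
Qed.

(** * Unit normal, second fundamental form and angle in coordinates *)

Lemma diff_unit_normal (R : realType) (V : normedModType R) m
    (nu : V -> 'rV[R]_m) (u w : V) :
  (forall z, dot (nu z) (nu z) = 1) -> differentiable nu u ->
  dot (nu u) ('d nu u w) = 0.
Proof.
move=> nu1 dnu.
have nuE : (fun z => dot (nu z) (nu z)) = cst 1 by exact/funext.
have := derive_dot w dnu dnu.
rewrite nuE derive_cst deriveE// [X in _ + X]dotC -mulr2n => /esym/eqP.
by rewrite mulrn_eq0 => /eqP.
Qed.

(** Differentiating [dot ('D_a f) nu = 0] along [b] gives [dot ('d f u a) ('d nu u b) = - dot ('D_b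
    ('D_a f) u) (nu u)], whose right-hand side is symmetric in [a] and [b]. *)
Lemma second_form_sym (R : realType) (V : normedModType R) m (U : set V)
    (f nu : V -> 'rV[R]_m) (u v w : V) :
  open U -> U u -> Ck 2 U f -> differentiable nu u ->
  (forall z e, U z -> dot ('d f z e) (nu z) = 0) ->
  dot ('d f u v) ('d nu u w) = dot ('d f u w) ('d nu u v).
Proof.
move=> oU Uu f2 dnu fnu; have [df Df] := f2.
have E a b : dot ('d f u a) ('d nu u b) = - dot ('D_b ('D_a f) u) (nu u).
  have [dDf _] := Df a.
  have z0 : \forall z \near u, dot ('D_a f z) (nu z) = 0 :> R.
    apply: filterS (open_nbhs_nbhs (conj oU Uu)) => z Uz.
    by rewrite deriveE ?fnu//; exact: df.
  have := near_eq_derive b z0.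
  rewrite derive_dot//; last exact: dDf.
  rewrite derive_cst (deriveE a (df u Uu)) (deriveE b dnu) => /eqP.
  by rewrite addr_eq0 => /eqP.
by rewrite !E (derive_comm_rV v w oU Uu f2).
Qed.

Lemma diffM_apply (R : realType) (V : normedModType R) (f g : V -> R)
    (u v : V) :
  differentiable f u -> differentiable g u ->
  'd (f * g) u v = f u * 'd g u v + g u * 'd f u v.
Proof. by move=> df dg; rewrite diffM. Qed.

Lemma diff_comp_apply (R : realType) (U V W : normedModType R) (f : U -> V)
    (g : V -> W) (u v : U) :
  differentiable f u -> differentiable g (f u) ->
  'd (g \o f) u v = 'd g (f u) ('d f u v).
Proof. by move=> df dg; rewrite diff_comp. Qed.

(** Near [u], [theta] is the arccosine of the inner product of [f] and [nu] divided by the length of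
    [f]. The nonzero tangential part keeps this quotient away from -1 and 1 at [u], where the
    arccosine is not differentiable. *)
Lemma diff_angle (R : realType) (V : normedModType R) m
    (f nu : V -> 'rV[R]_m) (theta : V -> R) (u w : V) :
  differentiable f u -> differentiable nu u -> dot (nu u) (nu u) = 1 ->
  f u - dot (f u) (nu u) *: nu u != 0 ->
  (forall z, 0 <= theta z <= pi /\
    Num.sqrt (dot (f z) (f z)) * cos (theta z) = dot (f z) (nu z)) ->
  dot (f u) ('d f u w) = 0 ->
  exists2 c : R, c != 0 &
    'd theta u w = c * (dot (f u) ('d nu u w) + dot ('d f u w) (nu u)).
Proof.
move=> df dnu nu1 T0 thetaP fw.
pose a z : R := dot (f z) (nu z); pose s z : R := dot (f z) (f z).
have das : differentiable a u by exact: differentiable_dot.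
have dss : differentiable s u by exact: differentiable_dot.
(* The gap [s u - a u ^+ 2] is the squared length of the tangential part. *)
have as2 : a u ^+ 2 < s u.
  rewrite -subr_gt0; move: T0; rewrite -dot_eq0 => T0.
  suff <- : dot (f u - a u *: nu u) (f u - a u *: nu u) = s u - a u ^+ 2.
    by rewrite lt_neqAle eq_sym T0 dot_ge0.
  rewrite !dotBl !dotBr !dotZl !dotZr nu1 [dot (nu u) _]dotC -/(a u) -/(s u).
  by rewrite mulr1 subrr subr0 expr2.
have s0 : 0 < s u by apply: le_lt_trans as2; exact: sqr_ge0.
pose b (r : R) : R := (Num.sqrt r)^-1.
have ss0 : 0 < Num.sqrt (s u) by rewrite sqrtr_gt0.
have db : differentiable b (s u).
  apply/derivable1_diffP; apply: derivableV; first exact: lt0r_neq0.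
  by have [] := is_derive1_sqrt s0.
pose q : V -> R := a * (b \o s).
have dbs := differentiable_comp dss db.
have dq : differentiable q u by exact: differentiableM.
(* The factor [b \o s] contributes nothing, since ['d s u w] is twice [dot (f u) ('d f u w)], which
   vanishes. *)
have dqw : 'd q u w = b (s u) * 'd a u w.
  apply: etrans (diffM_apply w das dbs) _.
  rewrite (diff_comp_apply w dss db) diff_dot// [X in 'd b _ X](_ : _ = 0).
    by rewrite linear0 mulr0 add0r.
  by rewrite [X in _ + X]dotC fw addr0.
have q1 : -1 < q u < 1.
  rewrite -ltr_norml -(@expr_lt1 _ 2)// real_normK ?num_real//.
  rewrite /q /= exprMn exprVn sqr_sqrtr; last exact: ltW.
  by rewrite ltr_pdivrMr// mul1r.
have dacos := is_derive1_acos q1.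
have ddacos : differentiable (@acos R) (q u).
  by apply/derivable1_diffP; have [] := dacos.
(* The bounds on [theta] select the principal branch; the division needs [s z] to be positive, which
   holds near [u] by continuity. *)
have near_theta : \forall z \near u, (@acos R \o q) z = theta z.
  have : \forall z \near u, 0 < s z.
    by apply: (cvgr_gt (s u)) => //; exact: differentiable_continuous.
  apply: filterS => z sz; have [thI thE] := thetaP z.
  rewrite /= /q /= fctE /= /a -thE mulrC /b mulKf; last first.
    by rewrite gt_eqF// sqrtr_gt0.
  by rewrite cosK// in_itv.
have [_ dth] := near_eq_diff near_theta (differentiable_comp dq ddacos).
(* The derivative of [acos] at [q u] times the inverse length of [f u]; geometrically,
   $-1/(\mu\sin\theta)$. *)
exists (- (Num.sqrt (1 - q u ^+ 2))^-1 * b (s u)).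
  rewrite mulf_neq0 ?oppr_eq0 ?invr_eq0 ?(gt_eqF ss0)//.
  rewrite sqrtr_eq0 -ltNge subr_gt0.
  by rewrite -real_normK ?num_real// expr_lt1// ltr_norml.
rewrite dth (diff_comp_apply w dq ddacos) dqw diff_dot//.
have <- : 'd (@acos R) (q u) 1 = - (Num.sqrt (1 - q u ^+ 2))^-1.
  by rewrite -deriveE//; case: dacos.
rewrite -[X in 'd _ _ X = _]mulr1 [LHS]linearZ -mulrA.
exact: mulrC.
Qed.

(** * The immersed hypersurface read in its charts *)

Section Immersed.
Variables (R : realType) (n : nat) (M : topologicalType).
Variable A : smooth_atlas R n M.

Lemma chart_img_open (i : chart_index A) (W : set M) :
  open W -> open (chart i @` (dom i `&` W)).
Proof.
move=> oW; rewrite openE => _ [q [iq Wq] <-].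
have nW : nbhs (chart i q) (param i @^-1` W).
  by apply: (param_cont iq); rewrite chartK//; exact: open_nbhs_nbhs.
have nU : nbhs (chart i q) (chart i @` dom i).
  by apply: open_nbhs_nbhs; split; [exact: img_open|exists q].
apply: filterS2 nW nU => z /= Wz [q' iq' E]; exists q' => //; split=> //.
by move: Wz; rewrite -E chartK.
Qed.

Lemma smooth_map_Ck (V : normedModType R) (F : M -> V) (i : chart_index A) k :
  smooth_map_on A setT F -> Ck k (chart i @` dom i) (F \o param i).
Proof. by move=> /(_ i k); rewrite setIT. Qed.

Lemma smooth_map_differentiable (V : normedModType R) (F : M -> V)
    (i : chart_index A) q :
  smooth_map_on A setT F -> dom i q ->
  differentiable (F \o param i) (chart i q).
Proof.
move=> Fs iq; have [dF _] := @smooth_map_Ck _ F i 1 Fs.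
by apply: dF; exists q.
Qed.

Variables x N : M -> 'rV[R]_n.+1.
Hypothesis x_immersion : immersion A x.
Hypothesis N_normal : unit_normal A x N.

Let x_smooth : smooth_map_on A setT x.
Proof. by case: x_immersion. Qed.
Let mdiff_inj : forall p, injective (mdiff A x p).
Proof. by case: x_immersion. Qed.
Let N_smooth : smooth_map_on A setT N.
Proof. by case: N_normal. Qed.
Let N1 p : dot (N p) (N p) = 1.
Proof. by case: N_normal. Qed.

(** [tangent] refers to the chart [chart_at A q]. On the overlap [x \o param i] factors through the
    transition map, so the chain rule turns a vector read in chart [i] into one read in that
    chart. *)
Lemma chart_tangent (i : chart_index A) q w : dom i q ->
  tangent A x q ('d (x \o param i) (chart i q) w).
Proof.
move=> iq; set j := chart_at A q; have jq : dom j q := dom_chart_at A q.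
have trE : (chart j \o param i) (chart i q) = chart j q by rewrite /= chartK.
have dtr : differentiable (chart j \o param i) (chart i q).
  have [dt _] := @transition_smooth _ _ _ A i j 1.
  by apply: dt; exists q.
have dx : differentiable (x \o param j) ((chart j \o param i) (chart i q)).
  by rewrite trE; exact: smooth_map_differentiable.
have E : \forall u \near chart i q,
    ((x \o param j) \o (chart j \o param i)) u = (x \o param i) u.
  have oU : open (chart i @` (dom i `&` dom j)).
    by apply: chart_img_open; exact: dom_open.
  have Uq : (chart i @` (dom i `&` dom j)) (chart i q) by exists q.
  apply: filterS (open_nbhs_nbhs (conj oU Uq)) => _ [q' [iq' jq'] <-].
  by rewrite /= (chartK iq') (chartK jq').
have [_ dE] := near_eq_diff E (differentiable_comp dtr dx).
exists ('d (chart j \o param i) (chart i q) w).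
by rewrite dE (diff_comp_apply w dtr dx) trE.
Qed.

(** The symmetry of second derivatives needs orthogonality to [N] throughout one fixed chart, not
    only at the point around which that chart was chosen. *)
Lemma chart_normal (i : chart_index A) u w : (chart i @` dom i) u ->
  dot ('d (x \o param i) u w) (N (param i u)) = 0.
Proof.
move=> [q iq <-]; rewrite chartK//; case: N_normal => _ _; apply.
exact: chart_tangent.
Qed.

Let param_chart p : param (chart_at A p) (chart (chart_at A p) p) = p.
Proof. exact/chartK/dom_chart_at. Qed.

Lemma mdiff_normal p w : dot (N p) (mdiff A N p w) = 0.
Proof.
rewrite -{1}(param_chart p).
apply: (@diff_unit_normal _ _ _ (N \o param (chart_at A p))).
  by move=> z; exact: N1.
exact/smooth_map_differentiable/dom_chart_at.
Qed.

(** This is the self-adjointness of the shape operator, up to sign. *)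
Lemma weingarten_sym p v w :
  dot (mdiff A x p v) (mdiff A N p w) = dot (mdiff A x p w) (mdiff A N p v).
Proof.
set i := chart_at A p.
apply: (@second_form_sym _ _ _ (chart i @` dom i)
  (x \o param i) (N \o param i)).
- exact: img_open.
- by exists p => //; exact: dom_chart_at.
- exact: smooth_map_Ck.
- exact/smooth_map_differentiable/dom_chart_at.
- by move=> z e Uz; exact: chart_normal.
Qed.

Lemma tangentP p v : tangent A x p v <-> dot v (N p) = 0.
Proof.
split; first by case: N_normal => _ _; apply.
have N0 : N p != 0 by rewrite -dot_eq0 N1 oner_eq0.
have mN w : dot (mdiff A x p w) (N p) = 0.
  by case: N_normal => _ _; apply; exists w.
exact: (tangent_hyperplane (@mdiff_inj p) N0 mN).
Qed.

Lemma deriv_alongE (V : normedModType R) (F : M -> V) p w :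
  deriv_along A x F p (mdiff A x p w) = mdiff A F p w.
Proof.
rewrite /deriv_along; congr (mdiff A F p _); apply: (@mdiff_inj p).
(* The default 0 of [xget] plays no part: [w] is itself a preimage, and by injectivity the only
   one. *)
exact: (@xgetI _ 0 [set w' | mdiff A x p w' = mdiff A x p w] w).
Qed.

Lemma dot_tangential_normal p : dot (tangential_part x N p) (N p) = 0.
Proof. by rewrite dotBl dotZl N1 mulr1 subrr. Qed.

Lemma dot_tangential p v : dot v (N p) = 0 ->
  dot v (tangential_part x N p) = dot v (x p).
Proof. by move=> vN; rewrite dotBr dotZr vN mulr0 subr0. Qed.

(** Both [mdiff A x p w] and [mdiff A N p w] are orthogonal to [N p], so pairing either with the
    position vector amounts to pairing it with the tangential part. *)
Lemma mdiff_angle (theta : M -> R) p w :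
  angle_function x N theta -> regular_set x N p ->
  dot (mdiff A x p w) (tangential_part x N p) = 0 ->
  exists2 c : R, c != 0 & mdiff A (theta : M -> R^o) p w =
    c * dot (tangential_part x N p) (mdiff A N p w).
Proof.
move=> thetaP Tp wT; set i := chart_at A p.
have xN : dot (mdiff A x p w) (N p) = 0 by apply/tangentP; exists w.
have [|||||| c c0 E] := @diff_angle R _ _ (x \o param i) (N \o param i)
    (theta \o param i) (chart i p) w.
- exact/smooth_map_differentiable/dom_chart_at.
- exact/smooth_map_differentiable/dom_chart_at.
- exact: N1.
- by rewrite /= param_chart.
- by move=> z; exact: thetaP.
- by rewrite /= param_chart dotC -dot_tangential.
have Nw : dot (mdiff A N p w) (N p) = 0 by rewrite dotC; exact: mdiff_normal.
have TN : dot (tangential_part x N p) (mdiff A N p w) =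
    dot (x p) (mdiff A N p w).
  exact: etrans (dotC _ _) (etrans (dot_tangential Nw) (dotC _ _)).
exists c => //; apply: etrans E _; congr (c * _).
by apply: etrans (esym TN); rewrite /= param_chart xN addr0.
Qed.

End Immersed.

(** * Tangent fields orthogonal to the tangential part of the position *)

(* Up to the factor [dot T T], the projection of [a] onto the orthogonal of
   [nu] and [T]; scaling by that factor avoids inverses, so that smoothness
   follows from that of sums and products. *)
Definition tangent_orthogonal_part (R : realType) m (a v nu : 'rV[R]_m) :
    'rV[R]_m :=
  let T := v - dot v nu *: nu in
  let b := a - dot a nu *: nu in
  dot T T *: b - dot b T *: T.

Lemma Ck_tangent_orthogonal_part (R : realType) (V : normedModType R) m k
    (U : set V) (f nu : V -> 'rV[R]_m) (a : 'rV[R]_m) :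
  open U -> Ck k U f -> Ck k U nu ->
  Ck k U (fun z => tangent_orthogonal_part a (f z) (nu z)).
Proof.
move=> oU cf cnu; have ca := @Ck_cst R V 'rV[R]_m k U a.
have cT := CkB oU cf (CkZ oU (Ck_dot oU cf cnu) cnu).
have cb := CkB oU ca (CkZ oU (Ck_dot oU ca cnu) cnu).
exact: (CkB oU (CkZ oU (Ck_dot oU cT cT) cb) (CkZ oU (Ck_dot oU cb cT) cT)).
Qed.

Lemma tangent_orthogonal_part_field (R : realType) (n : nat)
    (M : topologicalType) (A : smooth_atlas R n M) (x N : M -> 'rV[R]_n.+1)
    (a : 'rV[R]_n.+1) :
  immersion A x -> unit_normal A x N ->
  tangent_field_on A x (regular_set x N)
    (fun q => tangent_orthogonal_part a (x q) (N q)) /\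
  forall q,
    dot (tangent_orthogonal_part a (x q) (N q)) (tangential_part x N q) = 0.
Proof.
move=> immx norN; have [xs _] := immx; have [Ns N1 _] := norN.
split; last first.
  by move=> q; rewrite dotBl !dotZl mulrC subrr.
split=> [i k|q _].
  (* The formula is polynomial in the position and the normal, so it is smooth on the whole chart
     image and not only on the regular set. *)
  apply: (@Ck_sub _ _ _ _ (chart i @` dom i)).
    by move=> _ [q [iq _] <-]; exists q.
  apply: (@Ck_tangent_orthogonal_part _ _ _ k _ (x \o param i) (N \o param i)).
  - exact: img_open.
  - exact: smooth_map_Ck.
  - exact: smooth_map_Ck.
apply/(tangentP immx norN).
have T0 := dot_tangential_normal norN q.
rewrite dotBl !dotZl [dot (x q - _) (N q)]T0 mulr0 subr0.
have b0 : dot (a - dot a (N q) *: N q) (N q) = 0.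
  by rewrite dotBl dotZl N1 mulr1 subrr.
by rewrite b0 mulr0.
Qed.

Theorem proposition3p1 (R : realType) (n : nat) (M : topologicalType)
    (A : smooth_atlas R n M)
    (M_hausdorff : hausdorff_space M)
    (M_second_countable : @second_countable M)
    (M_connected : connected [set: M])
    (x N : M -> 'rV[R]_n.+1)
    (x_immersion : immersion A x)
    (N_unit_normal : unit_normal A x N)
    (theta : M -> R)
    (theta_angle : angle_function x N theta) :
  (forall p, regular_set x N p ->
     principal_direction A x N p (tangential_part x N p)) <->
  (forall Y : M -> 'rV[R]_n.+1,
     tangent_field_on A x (regular_set x N) Y ->
     (forall p, regular_set x N p -> dot (Y p) (tangential_part x N p) = 0) ->
     forall p, regular_set x N p ->
       deriv_along A x (theta : M -> R^o) p (Y p) = 0).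
Proof.
split=> [principal Y [_ Ytan] YT p Tp | theta0 p Tp].
  have [[t tE] _ [k Sk]] := principal p Tp.
  have [w wE] := Ytan p Tp; have wT := YT p Tp; rewrite -wE in wT *.
  have [c _ E] := mdiff_angle x_immersion N_unit_normal theta_angle Tp wT.
  apply: etrans (deriv_alongE x_immersion _ _ _) _; apply: etrans E _.
  (* Symmetry moves the derivative of [N] from [Y p] to the tangential part, where the eigenvalue
     equation makes it a multiple of a vector orthogonal to [Y p]. *)
  have sym := weingarten_sym x_immersion N_unit_normal p t w.
  rewrite tE in sym; rewrite sym.
  rewrite /shape_operator -{1}tE (deriv_alongE x_immersion) in Sk.
  have -> : mdiff A N p t = - (k *: tangential_part x N p).
    by rewrite -Sk opprK.
  by rewrite dotNr dotZr wT mulr0 oppr0 mulr0.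
set T := tangential_part x N p.
have TN : dot T (N p) = 0 := dot_tangential_normal N_unit_normal p.
have /(tangentP x_immersion N_unit_normal)[t tE] := TN.
(* [a] is minus the shape operator applied to [T]; the test field is built from it as a constant
   ambient vector. *)
pose a := mdiff A N p t.
have aN : dot a (N p) = 0.
  by rewrite dotC; exact: (mdiff_normal N_unit_normal).
have [Yfield YT] := tangent_orthogonal_part_field a x_immersion N_unit_normal.
have := theta0 _ Yfield (fun q _ => YT q) p Tp.
have [w wE] := Yfield.2 p Tp; have wT := YT p; rewrite -wE in wT *.
have [c c0 E] := mdiff_angle x_immersion N_unit_normal theta_angle Tp wT.
move=> /(etrans (esym (deriv_alongE x_immersion _ _ _))) D0.
have {D0 E} : c * dot T (mdiff A N p w) = 0 := etrans (esym E) D0.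
move/eqP; rewrite mulf_eq0 (negPf c0) /= => /eqP Tw.
(* By symmetry this is [Tw], the stationarity of [theta] along the test field at [p]. *)
have wa : dot (mdiff A x p w) a = 0.
  by rewrite (weingarten_sym x_immersion N_unit_normal) tE.
have wY : mdiff A x p w = dot T T *: a - dot a T *: T.
  by rewrite wE /tangent_orthogonal_part aN scale0r subr0.
(* At [p] the test field is a combination of [a] and [T] and is orthogonal to both, hence to
   itself. *)
have w0 : mdiff A x p w = 0.
  apply/eqP; rewrite -dot_eq0 {2}wY dotBr !dotZr wa.
  by rewrite [dot (mdiff _ _ _ _) T]wT !mulr0 subrr.
have TT : dot T T != 0 by rewrite dot_eq0.
split=> //; first by exists t.
(* The vanishing of the test field at [p] reads [dot T T *: a = dot a T *: T]; the sign comes from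
   the shape operator being minus the derivative of [N]. *)
exists (- (dot a T / dot T T)); rewrite /shape_operator -{1}tE.
rewrite (deriv_alongE x_immersion) -/a scaleNr; congr (- _).
apply: (scalerI TT); rewrite scalerA mulrCA divff// mulr1.
by apply: subr0_eq; rewrite -wY.
Qed.
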